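(* Let $\ell_\phi, n_0 \in \mathbb{N}_0$ be such that $2\ell_\phi < L$. Furthermore, let $\delta > 0$ and let $x,y \in \mathbb{C}^L$ be $B$-bandlimited, for some $B \in \mathbb{N}_0$. Let $G_\delta = (V_\delta,E)$ be the graph with vertex set $V_\delta = \{\ell \in \{0,\dots,L-1\} : \lvert x(\ell)\rvert \geq \delta\}$ and an edge between $\ell,k \in V_\delta$ if $\lvert \ell-k\rvert \in \{\ell_\phi, L-\ell_\phi\}$. Suppose that the subgraph of $G_\delta$ induced by the vertex set $S_\delta = V_\delta \cap \operatorname{supp} y$ is connected and that the window $\phi \in \mathbb{C}^L$ satisfies $$\operatorname{supp}(\phi) = \{n_0,\dots,n_0+\ell_\phi\} \bmod L$$ as well as $$\min_{k \in \{-2B,\dots,2B\}} \left\lvert \mathcal{F}\left[\lvert\phi\rvert^2\right](k)\right\rvert \geq \frac{1}{c}$$ for some $c > 0$. Then, $$\inf_{\alpha\in\mathbb{R}} \left\lVert x - \mathrm{e}^{\mathrm{i}\alpha} y\right\rVert_{\ell^2(V_\delta)} \leq \frac{1}{\delta}\left(c + \frac{2\sqrt{\lvert S_\delta\rvert L}\, \lVert x\rVert_{\ell^2(S_\delta)}}{\delta\, \lvert \phi(n_0)\phi(n_0+\ell_\phi)\rvert}\right)\left\lVert M_\phi[x]-M_\phi[y]\right\rVert_{\mathrm{F}}.$$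
   Context: Fix $L \in \mathbb{N}$. Vectors in $\mathbb{C}^L$ are indexed by $\{0,\dots,L-1\}$, and all indexing (of vectors and of $L\times L$ arrays) is periodic modulo $L$, e.g. $\phi(\ell) = \phi(\ell \bmod L)$ for $\ell \in \mathbb{Z}$. The support is $\operatorname{supp} x = \{\ell \in \{0,\dots,L-1\} : x(\ell) \neq 0\}$. The discrete Fourier transform (DFT) is $\mathcal{F}[x](k) = \frac{1}{\sqrt{L}}\sum_{\ell=0}^{L-1} x(\ell)\mathrm{e}^{-2\pi\mathrm{i}\ell k/L}$; $\lvert\phi\rvert^2$ denotes the vector with entries $\lvert\phi(\ell)\rvert^2$. The discrete Gabor transform of $x \in \mathbb{C}^L$ with window $\phi \in \mathbb{C}^L$ is $\mathcal{V}_\phi[x](m,n) = \frac{1}{\sqrt{L}} \sum_{\ell=0}^{L-1} x(\ell)\overline{\phi(\ell-m)}\mathrm{e}^{-2\pi\mathrm{i}\ell n/L}$, and the measurements are $M_\phi[x](m,n) := \lvert \mathcal{V}_\phi[x](m,n)\rvert^2$, $m,n=0,\dots,L-1$. $\lVert\cdot\rVert_{\mathrm{F}}$ is the Frobenius norm of $L\times L$ matrices. For $B \in \mathbb{N}_0$, $x \in \mathbb{C}^L$ is $B$-bandlimited if $\operatorname{supp} \mathcal{F}[x] \subset \{-B,\dots,B\} \bmod L$. For $S \subset \{0,\dots,L-1\}$, $\lVert x \rVert_{\ell^2(S)} = \left(\sum_{\ell \in S} \lvert x(\ell)\rvert^2\right)^{1/2}$, and $\lvert S\rvert$ is the cardinality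 of $S$. *)

(* Defs.v *)
From HB Require Import structures.
From mathcomp Require Import all_boot all_order all_algebra.
From mathcomp Require Import complex.
From mathcomp Require Import all_classical all_reals all_analysis.

Set Implicit Arguments.
Unset Strict Implicit.
Unset Printing Implicit Defensive.

Import Order.TTheory GRing.Theory Num.Theory.
Import Normc.

Local Open Scope classical_set_scope.
Local Open Scope ring_scope.
Local Open Scope complex_scope.

(* The modulus is taken in R (Normc.normc) wherever a real number is needed:
   the generic norm `|z| of R[i] has values in R[i]. *)

Definition expi (R : realType) (t : R) : R[i] := cos t +i* sin t.

(* x(l) for l in Z, indices being read modulo L. For L = 0, where there is no
   index at all, the value is the junk value 0. *)
Definition periodic_ext (R : realType) (L : nat) (x : 'cV[R[i]]_L) (l : int) : R[i] :=
  oapp (fun i : 'I_L => x i 0) 0 (insub (absz (l %% L%:Z)%Z)).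

Definition supp (R : realType) (L : nat) (x : 'cV[R[i]]_L) : {set 'I_L} :=
  [set l : 'I_L | x l 0 != 0].

(* {a, ..., a + n} mod L *)
Definition cyclic_interval (L : nat) (a : int) (n : nat) : {set 'I_L} :=
  [set l : 'I_L | [exists j : 'I_n.+1, (l%:Z == a + j%:Z %[mod L%:Z])%Z]].

Definition dft (R : realType) (L : nat) (x : 'cV[R[i]]_L) : 'cV[R[i]]_L :=
  \col_k (((Num.sqrt L%:R)^-1)%:C *
          \sum_(l < L) x l 0 * expi (- (2 * pi * l%:R * k%:R / L%:R))).

Definition sqmod (R : realType) (L : nat) (x : 'cV[R[i]]_L) : 'cV[R[i]]_L :=
  \col_l (normc (x l 0) ^+ 2)%:C.

Definition gabor (R : realType) (L : nat) (phi x : 'cV[R[i]]_L) : 'M[R[i]]_L :=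
  \matrix_(m, n) (((Num.sqrt L%:R)^-1)%:C *
    \sum_(l < L) x l 0 * (periodic_ext phi (l%:Z - m%:Z))^*
                 * expi (- (2 * pi * l%:R * n%:R / L%:R))).

Definition measurements (R : realType) (L : nat) (phi x : 'cV[R[i]]_L) :
    'M[R]_L :=
  \matrix_(m, n) normc (gabor phi x m n) ^+ 2.

Definition frobenius_norm (R : realType) (L : nat) (A : 'M[R]_L) : R :=
  Num.sqrt (\sum_(m < L) \sum_(n < L) `|A m n| ^+ 2).

Definition bandlimited (R : realType) (L : nat) (B : nat) (x : 'cV[R[i]]_L) :
    bool :=
  supp (dft x) \subset cyclic_interval L (- B%:Z) (2 * B).

Definition l2norm_on (R : realType) (L : nat) (S : {set 'I_L})
    (x : 'cV[R[i]]_L) : R :=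
  Num.sqrt (\sum_(l in S) normc (x l 0) ^+ 2).

(* min over k in {-K, ..., K} of |x(k)|; the seed of the iterated minimum is
   the value at k = 0, which belongs to the range. *)
Definition min_modulus_band (R : realType) (L : nat) (x : 'cV[R[i]]_L)
    (K : nat) : R :=
  \big[Num.min/normc (periodic_ext x 0)]_(j < (2 * K).+1)
     normc (periodic_ext x (j%:Z - K%:Z)).

Definition large_set (R : realType) (L : nat) (delta : R) (x : 'cV[R[i]]_L) :
    {set 'I_L} :=
  [set l : 'I_L | delta <= normc (x l 0)].

(* Adjacency in the graph with vertex set V; for lphi = 0 it consists of loops
   only, which do not affect connectedness. *)
Definition shift_graph (L : nat) (V : {set 'I_L}) (lphi : nat) : rel 'I_L :=
  fun l k => [&& l \in V, k \in V &
               absz (l%:Z - k%:Z) \in [:: lphi; (L - lphi)%N]].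

Definition induced (T : finType) (e : rel T) (S : {set T}) : rel T :=
  fun l k => [&& l \in S, k \in S & e l k].

(* Any two vertices in S are joined by a path inside S; the graph with no
   vertices counts as connected. *)
Definition induced_connected (T : finType) (e : rel T) (S : {set T}) : Prop :=
  {in S &, forall l k, connect (induced e S) l k}.

(* Main.v *)
(* Taking the discrete Fourier transform of the spectrogram in the frequency
   variable gives, for each shift m, the autocorrelation of the windowed signal
   x conj(phi(. - m)); by Parseval, each lag of the difference of these
   autocorrelations is controlled by ||M_phi[x] - M_phi[y]||_F.
   - Lag 0 is the correlation of |x|^2 - |y|^2, which is 2B-bandlimited, with
     |phi|^2, so the lower bound on F[|phi|^2] recovers |x|^2 - |y|^2 with
     constant c.
   - Since 2 lphi < L, at lag lphi the window overlaps its translate in the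
     single point n0, so the products x(l + lphi) conj(x(l)) are recovered with
     constant sqrt(L) / |phi(n0) phi(n0 + lphi)|. They give the relative phases
     of x and y across the edges of the graph, which add up along a simple
     path of S; Cauchy-Schwarz over its edges yields the factor sqrt(|S|). *)

Require Import Defs.
From HB Require Import structures.
From mathcomp Require Import all_boot all_order all_algebra.
From mathcomp Require Import complex.
From mathcomp Require Import all_classical all_reals all_analysis.
From mathcomp Require Import ring lra zify.

Set Implicit Arguments.
Unset Strict Implicit.
Unset Printing Implicit Defensive.

Import Order.TTheory GRing.Theory Num.Theory.
Import Normc.

Local Open Scope classical_set_scope.
Local Open Scope ring_scope.
Local Open Scope complex_scope.

(** * Cauchy-Schwarz and Minkowski inequalities for finite real sums *)

Section RealSums.
Variables (R : rcfType) (I : finType).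
Implicit Types (P : pred I) (a b : I -> R).

(** Lagrange's identity: twice the defect is the double sum of the squares $(a_i b_j - a_j
    b_i)^2$. *)
Lemma sum_prod_sqr_le P a b :
  (\sum_(i | P i) a i * b i) ^+ 2 <=
  (\sum_(i | P i) a i ^+ 2) * (\sum_(i | P i) b i ^+ 2).
Proof.
rewrite -subr_ge0 -(pmulrn_lge0 _ (isT : (0 < 2)%N)).
have -> : ((\sum_(i | P i) a i ^+ 2) * (\sum_(i | P i) b i ^+ 2) -
           (\sum_(i | P i) a i * b i) ^+ 2) *+ 2 =
    \sum_(i | P i) \sum_(j | P j) (a i * b j - a j * b i) ^+ 2.
  transitivity (\sum_(i | P i) \sum_(j | P j)
      (a i ^+ 2 * b j ^+ 2 + b i ^+ 2 * a j ^+ 2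
       - (a i * b i) * (a j * b j) *+ 2)).
    under [RHS]eq_bigr do rewrite sumrB big_split /= sumrMnl -!mulr_sumr.
    rewrite sumrB big_split /= sumrMnl -!mulr_suml; ring.
  by apply: eq_bigr => i _; apply: eq_bigr => j _; ring.
by apply: sumr_ge0 => i _; apply: sumr_ge0 => j _; exact: sqr_ge0.
Qed.

Lemma sum_le_sqrt_card (A : {set I}) a :
  \sum_(i in A) a i <= Num.sqrt #|A|%:R * Num.sqrt (\sum_(i in A) a i ^+ 2).
Proof.
apply: le_trans (ler_norm _) _; rewrite -sqrtr_sqr -sqrtrM ?ler0n//.
rewrite ler_wsqrtr//.
have := sum_prod_sqr_le [in A] (fun=> 1) a.
rewrite (eq_bigr _ (fun i _ => mul1r (a i))).
by under [in X in X * _]eq_bigr do rewrite expr1n; rewrite sumr_const.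
Qed.

Lemma sqrt_sum_sqrD_le P a b :
  Num.sqrt (\sum_(i | P i) (a i + b i) ^+ 2) <=
  Num.sqrt (\sum_(i | P i) a i ^+ 2) + Num.sqrt (\sum_(i | P i) b i ^+ 2).
Proof.
have sqr_sum_ge0 f : 0 <= \sum_(i | P i) f i ^+ 2 :> R.
  by apply: sumr_ge0 => i _; exact: sqr_ge0.
rewrite -(@ler_pXn2r _ 2) ?nnegrE ?addr_ge0 ?sqrtr_ge0//.
rewrite sqrrD !sqr_sqrtr//.
under eq_bigr do rewrite sqrrD; rewrite big_split big_split /= sumrMnl.
rewrite lerD2r lerD2l lerMn2r/= -sqrtrM//.
apply: le_trans (ler_norm _) _; rewrite -sqrtr_sqr.
by rewrite ler_wsqrtr// sum_prod_sqr_le.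
Qed.

End RealSums.

(** * Modulus, phase and the unit circle in $\mathbb{C}$ *)

Section Modulus.
Variable R : realType.
Implicit Types (z w : R[i]) (t : R).

Lemma normc_sqr z : (normc z ^+ 2)%:C = z * z^*%R.
Proof. by rewrite rmorphXn -sqr_normc normc_def; case: z. Qed.

Lemma normc_ge0 z : 0 <= normc z.
Proof. by case: z => u v; exact: sqrtr_ge0. Qed.

Lemma normc_real t : normc t%:C = `|t|.
Proof. by rewrite /= expr0n addr0 sqrtr_sqr. Qed.

Lemma normc_conj z : normc z^*%R = normc z.
Proof. by case: z => u v /=; rewrite sqrrN. Qed.

Lemma normc_gt0 z : (0 < normc z) = (z != 0).
Proof.
rewrite lt0r normc_ge0 andbT; congr negb; apply/eqP/eqP => [/eq0_normc//|->].
exact: normc0.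
Qed.

Lemma normcB_sym z w : normc (z - w) = normc (w - z).
Proof. by rewrite -normcN opprB. Qed.

Lemma normc_sub_triangle z w v : normc (z - w) <= normc (z - v) + normc (v - w).
Proof. by rewrite -[z - w](subrKA v) le_normcD. Qed.

Lemma normc_dist_le z w : `|normc z - normc w| <= normc (z - w).
Proof.
have h u v : normc u - normc v <= normc (u - v).
  by rewrite lerBlDr -{1}(subrK v u) le_normcD.
by rewrite ler_norml h lerNl opprB normcB_sym h.
Qed.

(** The phase of $z$. Division by zero gives [csgn 0 = 0], so multiplicativity and the polar form
    [csgnK] hold without assuming $z \neq 0$. *)
Definition csgn z : R[i] := z / (normc z)%:C.

Lemma csgnM z w : csgn (z * w) = csgn z * csgn w.
Proof. by rewrite /csgn normcM rmorphM invfM mulrACA. Qed.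

Lemma csgn_conj z : csgn z^*%R = (csgn z)^*%R.
Proof.
rewrite /csgn normc_conj [RHS]rmorphM -fmorphV; congr (_ * _).
by apply/esym; exact: conjc_real.
Qed.

Lemma normc_csgn z : z != 0 -> normc (csgn z) = 1.
Proof.
rewrite -normc_gt0 => z0.
by rewrite /csgn normcM normcV normc_real gtr0_norm ?divff// gt_eqF.
Qed.

Lemma csgnK z : (normc z)%:C * csgn z = z.
Proof.
have [->|z0] := eqVneq z 0; first by rewrite /csgn mul0r mulr0.
rewrite /csgn mulrCA divff ?mulr1// -(rmorph0 (real_complex R)).
by rewrite (inj_eq (@complexI _)) gt_eqF// normc_gt0.
Qed.

(** Multiplied by $|z|$, the difference of phases is $(z - w) + (|w| - |z|)$ [csgn w], and each
    summand has modulus at most $|z - w|$; hence the factor 2 of the final bound. *)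
Lemma csgn_dist_le z w : z != 0 -> w != 0 ->
  normc (csgn z - csgn w) <= 2 * normc (z - w) / normc z.
Proof.
move=> z0 w0; have nz : 0 < normc z by rewrite normc_gt0.
rewrite ler_pdivlMr//.
have -> : normc (csgn z - csgn w) * normc z =
          normc ((z - w) + ((normc w - normc z)%:C * csgn w)).
  rewrite -[X in _ * X]ger0_norm ?normc_ge0// -normc_real -normcM.
  congr normc; rewrite mulrBl [_ * _%:C]mulrC csgnK rmorphB mulrBl csgnK.
  by rewrite addrA subrK mulrC.
apply: le_trans (le_normcD _ _) _.
rewrite normcM normc_csgn// mulr1 normc_real mulr_natl mulr2n lerD2l.
by rewrite normcB_sym normc_dist_le.
Qed.

Lemma expi0 : expi 0 = 1 :> R[i].
Proof. by rewrite /expi cos0 sin0. Qed.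

Lemma expiD s t : expi (s + t) = expi s * expi t.
Proof. by rewrite /expi cosD sinD; simpc; congr (_ +i* _); rewrite addrC. Qed.

Lemma expiN t : expi (- t) = (expi t)^*%R.
Proof. by rewrite /expi cosN sinN. Qed.

Lemma normc_expi t : normc (expi t) = 1.
Proof. by rewrite /= cos2Dsin2 sqrtr1. Qed.

Lemma expi_period m t : expi (t + 2 * pi * m%:R) = expi t.
Proof.
have -> : 2 * pi * m%:R = (pi *+ 2) *+ m :> R by rewrite mulr_natl mulr_natr.
by rewrite /expi (periodicn (@cosD2pi R)) (periodicn (@sinD2pi R)).
Qed.

Lemma unit_circle_expi z : normc z = 1 -> exists t, z = expi t.
Proof.
case: z => u v /= h1.
have h : u ^+ 2 + v ^+ 2 = 1.
  by rewrite -[LHS]sqr_sqrtr ?h1 ?expr1n// addr_ge0 ?sqr_ge0.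
have u1 : -1 <= u <= 1.
  by rewrite -ler_norml -(@expr_le1 _ 2)// real_normK ?num_real// -h lerDl sqr_ge0.
have [v0|v0] := leP 0 v.
  exists (acos u); rewrite /expi acosK// sin_acos//.
  by rewrite -h addrAC subrr add0r sqrtr_sqr ger0_norm.
exists (- acos u); rewrite /expi cosN sinN acosK// sin_acos//.
by rewrite -h addrAC subrr add0r sqrtr_sqr ltr0_norm// opprK.
Qed.

End Modulus.

(** * Integer indices modulo $L = n + 1$ *)

Section CyclicIndices.
Variable n : nat.

(** Addition on ['I_n.+1] is modulo $n + 1$ and [residue] is additive, so periodic indexing becomes
    arithmetic in this group. *)
Definition residue (z : int) : 'I_n.+1 := inZp (absz (z %% n.+1)%Z).

Lemma modz_succ_ge0 z : 0 <= (z %% n.+1)%Z.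
Proof. by rewrite modz_ge0. Qed.

Lemma absz_modz_lt z : (absz (z %% n.+1)%Z < n.+1)%N.
Proof. by rewrite -ltz_nat gez0_abs ?modz_succ_ge0// ltz_pmod. Qed.

Lemma val_residue z : (residue z)%:Z = (z %% n.+1)%Z.
Proof.
by rewrite /residue /= modn_small ?absz_modz_lt// gez0_abs ?modz_succ_ge0.
Qed.

Lemma eq_residue z w : (z == w %[mod n.+1])%Z = (residue z == residue w).
Proof. by rewrite -!val_residue. Qed.

Lemma residueK (l : 'I_n.+1) : residue l%:Z = l.
Proof.
apply/val_inj/eqP; rewrite -eqz_nat val_residue modz_small ?eqxx//=.
by rewrite ltz_nat ltn_ord.
Qed.

Lemma residueD z w : residue (z + w) = residue z + residue w.
Proof.
apply/val_inj/eqP; rewrite -eqz_nat val_residue /= -modz_nat PoszD.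
by rewrite !val_residue modzDm.
Qed.

Lemma residue0 : residue 0 = 0.
Proof. by apply/val_inj; rewrite /= mod0n. Qed.

Lemma residueN z : residue (- z) = - residue z.
Proof.
by apply/eqP; rewrite -subr_eq0 opprK -residueD addNr residue0.
Qed.

Lemma residueB z w : residue (z - w) = residue z - residue w.
Proof. by rewrite residueD residueN. Qed.

Lemma residue_period : residue n.+1%:Z = 0.
Proof. by apply/val_inj; rewrite /= modzz mod0n. Qed.

Lemma periodic_extE (R : realType) (x : 'cV[R[i]]_n.+1) z :
  periodic_ext x z = x (residue z) 0.
Proof.
have lt_z := absz_modz_lt z.
rewrite /periodic_ext insubT /=; congr (x _ 0).
by apply/val_inj; rewrite /= modn_small.
Qed.

Lemma cyclic_intervalP a m (l : 'I_n.+1) :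
  reflect (exists2 j : nat, (j <= m)%N & l = residue (a + j%:Z))
          (l \in cyclic_interval n.+1 a m).
Proof.
rewrite inE; apply: (iffP existsP) => [[j]|[j jm ->]].
  by rewrite eq_residue residueK => /eqP ->; exists j => //; rewrite -ltnS.
by exists (Ordinal (jm : (j < m.+1)%N)); rewrite eq_residue residueK.
Qed.

End CyclicIndices.

(** * Fourier analysis on the cyclic group of order $n + 1$ *)

Section Fourier.
Variables (R : realType) (n : nat).
Local Notation G := 'I_n.+1.
Local Notation C := R[i].
Implicit Types (f g : G -> C) (l k m : G).

Definition chi (l k : G) : C := expi (2 * pi * l%:R * k%:R / n.+1%:R).

Lemma chi_sym l k : chi l k = chi k l.
Proof. by congr expi; ring. Qed.

Lemma chiDl l m k : chi (l + m) k = chi l k * chi m k.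
Proof.
rewrite /chi -expiD.
(* The sum of the representatives exceeds that of $l + m$ in the group by $q (n + 1)$, which turns
   the argument by $qk$ full periods. *)
set q := ((l + m) %/ n.+1)%N.
have lmE : l%:R + m%:R = q%:R * n.+1%:R + (l + m)%R%:R :> R.
  by rewrite -natrM -!natrD -divn_eq.
rewrite -[LHS](expi_period (q * k)); congr expi.
have n0 : n.+1%:R != 0 :> R by rewrite pnatr_eq0.
have -> : (l + m)%R%:R = l%:R + m%:R - q%:R * n.+1%:R :> R.
  by rewrite lmE addrAC subrr add0r.
by rewrite natrM; field; rewrite addrC natr1.
Qed.

Lemma chi0l k : chi 0 k = 1.
Proof. by rewrite /chi /= mulr0 !mul0r expi0. Qed.

Lemma normc_chi l k : normc (chi l k) = 1.
Proof. exact: normc_expi. Qed.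

Lemma chi_conj_mul l k : chi l k * (chi l k)^* = 1.
Proof. by rewrite -normc_sqr normc_chi expr1n. Qed.

Lemma chiNl l k : chi (- l) k = (chi l k)^*.
Proof.
by rewrite -[LHS]mulr1 -(chi_conj_mul l k) mulrA -chiDl addNr chi0l mul1r.
Qed.

Lemma chiBl l m k : chi (l - m) k = chi l k * (chi m k)^*.
Proof. by rewrite chiDl chiNl. Qed.

(** With $t = \pi l/(n+1) \in (0, \pi)$ the value is $\mathrm{e}^{2\mathrm{i}t}$; were it 1, then
    $\cos 2t = 1$ and $\sin t = 0$, which is impossible on that interval. *)
Lemma chi_neq1 l : l != 0 -> chi l (residue n 1) != 1.
Proof.
move=> l0; have lgt0 : (0 < l)%N by rewrite lt0n.
have n1 : (1 < n.+1)%N := leq_ltn_trans lgt0 (ltn_ord l).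
have r1 : (residue n 1)%:R = 1 :> R.
  rewrite (_ : nat_of_ord _ = 1%N)//; apply/eqP.
  by rewrite -eqz_nat val_residue modz_small.
rewrite /chi r1 mulr1; apply: contraTneq isT => chi1.
pose t : R := pi * l%:R / n.+1%:R.
have tE : 2 * pi * l%:R / n.+1%:R = t *+ 2 by rewrite /t -mulr_natl; ring.
have : 0 < sin t.
  apply: sin_gt0_pi; rewrite divr_gt0 ?mulr_gt0 ?pi_gt0 ?ltr0n//=.
  by rewrite ltr_pdivrMr ?ltr0n// ltr_pM2l ?pi_gt0// ltr_nat.
have /(congr1 (@complex.Re R)) := chi1; rewrite tE /= cos_mulr2n cos2sin2 => h.
have -> : sin t = 0 by apply/eqP; rewrite -sqrf_eq0; apply/eqP; lra.
by rewrite ltxx.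
Qed.

(** For $l \neq 0$, translating $k$ by 1 multiplies the sum by a number other than 1 and leaves it
    unchanged, so it vanishes. *)
Lemma sum_chi l : \sum_k chi l k = n.+1%:R * (l == 0)%:R.
Proof.
have [->|l0] := eqVneq l 0.
  rewrite (eq_bigr (fun=> 1)) => [|k _]; last exact: chi0l.
  by rewrite sumr_const card_ord mulr1.
rewrite mulr0; set s := LHS.
have : chi l (residue n 1) * s = s.
  rewrite /s mulr_sumr [RHS](reindex_inj (addrI (residue n 1))).
  by apply: eq_bigr => k _; rewrite [in RHS]chi_sym chiDl !(chi_sym l).
move/eqP; rewrite -subr_eq0 -{2}[s]mul1r -mulrBl mulf_eq0 subr_eq0.
by rewrite (negPf (chi_neq1 l0)) => /eqP.
Qed.

(** The transform without the factor $1/\sqrt{L}$, which [dftE] restores. *)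
Definition ft f k : C := \sum_l f l * (chi l k)^*.

Lemma ftB f g k : ft (fun l => f l - g l) k = ft f k - ft g k.
Proof. by rewrite /ft -sumrB; apply: eq_bigr => l _; rewrite mulrBl. Qed.

Lemma ft_inversion f l : n.+1%:R * f l = \sum_k ft f k * chi l k.
Proof.
under eq_bigr do rewrite mulr_suml.
rewrite exchange_big /= (bigD1 l)//= [X in _ + X]big1 ?addr0 => [|m ml].
  under eq_bigr do rewrite -mulrA (mulrC (_^*)) chi_conj_mul mulr1.
  by rewrite sumr_const card_ord mulr_natl.
under eq_bigr do rewrite -mulrA (mulrC (_^*)) -chiBl.
by rewrite -mulr_sumr sum_chi subr_eq0 eq_sym (negPf ml) !mulr0.
Qed.

Lemma parseval f :
  \sum_k normc (ft f k) ^+ 2 = n.+1%:R * \sum_l normc (f l) ^+ 2.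
Proof.
apply: complexI; rewrite rmorphM /= !rmorph_sum rmorph_nat /= mulr_sumr.
under [RHS]eq_bigr do rewrite normc_sqr mulrA ft_inversion mulr_suml.
rewrite exchange_big; apply: eq_bigr => k _ /=.
rewrite normc_sqr {2}/ft rmorph_sum mulr_sumr; apply: eq_bigr => l _ /=.
by rewrite rmorphM /= conjCK; ring.
Qed.

Lemma ft_correlation f g k :
  ft (fun m => \sum_l f l * (g (l - m))^*) k = ft f k * (ft g k)^*.
Proof.
rewrite /ft rmorph_sum /= mulr_suml.
under eq_bigr do rewrite mulr_suml.
rewrite exchange_big; apply: eq_bigr => l _ /=.
rewrite mulr_sumr (reindex_inj (subrI l)); apply: eq_bigr => m _ /=.
by rewrite subKr rmorphM /= conjCK chiBl rmorphM /= conjCK; ring.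
Qed.

Lemma sqr_ft_autocorrelation f k :
  ft f k * (ft f k)^* = ft (fun m => \sum_l f l * (f (l - m))^*) k.
Proof. by rewrite ft_correlation. Qed.

(** Inversion applied to one factor of $|f|^2$. The autocorrelation of the spectrum on the right
    shows that the band at most doubles. *)
Lemma ft_sqr_modulus f k :
  n.+1%:R * ft (fun l => f l * (f l)^*) k = \sum_m ft f m * (ft f (m - k))^*.
Proof.
rewrite mulr_sumr.
under eq_bigr => l _.
  rewrite !mulrA ft_inversion !mulr_suml.
  over.
rewrite exchange_big; apply: eq_bigr => m _ /=.
rewrite /ft rmorph_sum mulr_sumr; apply: eq_bigr => l _ /=.
rewrite rmorphM /= conjCK (chi_sym l (m - k)) chiBl !(chi_sym _ l); ring.
Qed.

End Fourier.

(** * Estimates from the spectrogram at lags 0 and [lphi] *)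

Section GaborMeasurements.
Variables (R : realType) (n : nat).
Local Notation G := 'I_n.+1.
Local Notation N := (n.+1%:R : R).
Implicit Types (x y phi : 'cV[R[i]]_n.+1) (f g : G -> R[i]) (k l m : G).

Lemma dftE x k : dft x k 0 = (Num.sqrt N)^-1%:C * ft (x^~ 0) k.
Proof.
rewrite mxE /ft; congr (_ * _); apply: eq_bigr => l _.
by rewrite /chi expiN.
Qed.

Lemma sqr_normc_dft x k : normc (dft x k 0) ^+ 2 = N^-1 * normc (ft (x^~ 0) k) ^+ 2.
Proof.
rewrite dftE normcM normc_real exprMn ger0_norm ?invr_ge0 ?sqrtr_ge0//.
by rewrite exprVn sqr_sqrtr.
Qed.

Lemma dft_eq0 x k : (dft x k 0 == 0) = (ft (x^~ 0) k == 0).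
Proof.
rewrite dftE mulf_eq0 -(rmorph0 (real_complex R)) (inj_eq (@complexI _)).
by rewrite invr_eq0 gt_eqF// sqrtr_gt0 ltr0n.
Qed.

Definition windowed phi x m l : R[i] := x l 0 * (phi (l - m) 0)^*.

Definition autocorrelation f k : R[i] := \sum_l f l * (f (l - k))^*.

Lemma measurementsE phi x m k :
  measurements phi x m k = N^-1 * normc (ft (windowed phi x m) k) ^+ 2.
Proof.
have gaborE : gabor phi x m k = dft (\col_l windowed phi x m l) k 0.
  rewrite !mxE; congr (_ * _); apply: eq_bigr => l _.
  by rewrite mxE periodic_extE residueB !residueK.
rewrite mxE gaborE sqr_normc_dft; congr (_ * normc _ ^+ 2).
by apply: eq_bigr => l _; rewrite mxE.
Qed.

(** The squared modulus of a transform is the transform of the autocorrelation, so Parseval applies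
    to the difference. *)
Lemma sum_sqr_ft_sqrB f g :
  \sum_k (normc (ft f k) ^+ 2 - normc (ft g k) ^+ 2) ^+ 2 =
  N * \sum_k normc (autocorrelation f k - autocorrelation g k) ^+ 2.
Proof.
rewrite -parseval; apply: eq_bigr => k _.
rewrite ftB -!sqr_ft_autocorrelation -!normc_sqr -rmorphB normc_real.
by rewrite real_normK ?num_real.
Qed.

Lemma frobenius_norm_measurementsB phi x y :
  N * frobenius_norm (measurements phi x - measurements phi y) ^+ 2 =
  \sum_k \sum_m normc (autocorrelation (windowed phi x m) k -
                       autocorrelation (windowed phi y m) k) ^+ 2.
Proof.
have N0 : N != 0 by rewrite pnatr_eq0.
rewrite sqr_sqrtr; last by do 2![apply: sumr_ge0 => ? _]; exact: sqr_ge0.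
rewrite [RHS]exchange_big mulr_sumr; apply: eq_bigr => m _ /=.
(* Each measurement carries $1/N$, hence $1/N^2$ after squaring, while Parseval returns one $N$; the
   extra factor $N$ balances the two. *)
apply: (mulfI N0); rewrite -sum_sqr_ft_sqrB mulrA mulr_sumr.
apply: eq_bigr => k _.
rewrite real_normK ?num_real// mxE [X in _ + X]mxE !measurementsE.
by rewrite -mulrBr exprMn mulrA -expr2 exprVn divff ?mul1r// expf_neq0.
Qed.

Lemma sum_autocorrelation_le phi x y k :
  \sum_m normc (autocorrelation (windowed phi x m) k -
                autocorrelation (windowed phi y m) k) ^+ 2 <=
  N * frobenius_norm (measurements phi x - measurements phi y) ^+ 2.
Proof.
rewrite frobenius_norm_measurementsB [leRHS](bigD1 k)//= lerDl.
by do 2![apply: sumr_ge0 => ? _]; exact: sqr_ge0.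
Qed.

Lemma bandlimited_sqr_modulus B x k : bandlimited B x ->
  ft (fun l => x l 0 * (x l 0)^*) k != 0 ->
  k \in cyclic_interval n.+1 (- (2 * B)%:Z) (2 * (2 * B)).
Proof.
move=> /fintype.subsetP xB; apply: contraNT => kB; apply/eqP.
have N0 : n.+1%:R != 0 :> R[i] by rewrite pnatr_eq0.
apply: (mulfI N0); rewrite mulr0 ft_sqr_modulus big1// => m _.
apply/eqP; apply: contraNT kB; rewrite mulf_eq0 negb_or conjC_eq0 -!dft_eq0.
move=> /andP[mB mkB].
have /cyclic_intervalP[i iB mE] : m \in cyclic_interval n.+1 (- B%:Z) (2 * B).
  by apply: xB; rewrite inE.
have /cyclic_intervalP[j jB mkE] : m - k \in cyclic_interval n.+1 (- B%:Z) (2 * B).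
  by apply: xB; rewrite inE.
(* With $m = -B + i$ and $m - k = -B + j$, one has $k = i - j = -2B + (2B + i - j)$. *)
apply/cyclic_intervalP; exists (2 * B + i - j)%N; first lia.
by rewrite -[LHS](subKr m) mkE mE -residueB; congr residue; lia.
Qed.

Lemma min_modulus_band_le x K j : (j <= 2 * K)%N ->
  min_modulus_band x K <= normc (x (residue n (- K%:Z + j%:Z)) 0).
Proof.
rewrite -ltnS => jK; rewrite -periodic_extE addrC.
exact: (bigmin_le_cond _ _ (j := Ordinal jK)).
Qed.

Lemma sum_sqr_modulusB_le B phi x y c : 0 < c ->
  bandlimited B x -> bandlimited B y ->
  1 / c <= min_modulus_band (dft (sqmod phi)) (2 * B) ->
  \sum_l (normc (x l 0) ^+ 2 - normc (y l 0) ^+ 2) ^+ 2 <=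
  c ^+ 2 * frobenius_norm (measurements phi x - measurements phi y) ^+ 2.
Proof.
move=> c0 xB yB cphi.
have N0 : 0 < N by rewrite ltr0n.
pose d l : R[i] := x l 0 * (x l 0)^* - y l 0 * (y l 0)^*.
pose w l : R[i] := sqmod phi l 0.
have dE l : normc (d l) ^+ 2 = (normc (x l 0) ^+ 2 - normc (y l 0) ^+ 2) ^+ 2.
  by rewrite /d -!normc_sqr -rmorphB normc_real real_normK ?num_real.
under eq_bigr do rewrite -dE.
(* Either [ft d k] vanishes, or $k$ lies in the band of radius $2B$, where the hypothesis reads
   $|$[ft w k]$|^2 \geq N/c^2$ without the normalisation. *)
have wd k : normc (ft d k) ^+ 2 * N <= c ^+ 2 * normc (ft d k * (ft w k)^*) ^+ 2.
  have [->|dk] := eqVneq (ft d k) 0; first by rewrite mul0r normc0 expr0n mul0r mulr0.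
  have kB : k \in cyclic_interval n.+1 (- (2 * B)%:Z) (2 * (2 * B)).
    move: dk; rewrite /d ftB.
    have [/(bandlimited_sqr_modulus xB)//|/negPn/eqP->] :=
      boolP (ft (fun l => x l 0 * (x l 0)^*) k != 0).
    by rewrite sub0r oppr_eq0 => /(bandlimited_sqr_modulus yB).
  have /cyclic_intervalP[j jB kE] := kB.
  have : c^-1 ^+ 2 <= normc (dft (sqmod phi) k 0) ^+ 2.
    rewrite ler_pXn2r ?nnegrE ?normc_ge0 ?invr_ge0 ?(ltW c0)//.
    by rewrite kE -[c^-1]div1r; apply: le_trans cphi _; exact: min_modulus_band_le.
  rewrite sqr_normc_dft exprVn -/w => h.
  rewrite normcM normc_conj exprMn mulrCA ler_wpM2l ?sqr_ge0//.
  by move: h; rewrite ler_pdivlMl// ler_pdivrMr ?exprn_gt0// mulrC.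
rewrite -(ler_pM2l (mulr_gt0 N0 N0)).
have -> : N * N * (\sum_l normc (d l) ^+ 2) = \sum_k normc (ft d k) ^+ 2 * N.
  by rewrite -mulr_suml parseval; ring.
apply: le_trans (ler_sum _ (fun k _ => wd k)) _.
rewrite -mulr_sumr; under eq_bigr do rewrite -ft_correlation.
rewrite parseval [leRHS]mulrCA ler_wpM2l ?sqr_ge0// -mulrA.
rewrite ler_wpM2l ?ler0n//.
(* At lag 0 the autocorrelations of the windowed signals are the correlations of $|x|^2$ and $|y|^2$
   with $|\phi|^2$. *)
apply: le_trans (sum_autocorrelation_le phi x y 0).
apply: ler_sum => m _; rewrite le_eqVlt; apply/orP; left; apply/eqP.
congr (normc _ ^+ 2); rewrite -sumrB; apply: eq_bigr => l _.
by rewrite /windowed /w mxE subr0 normc_sqr !rmorphM /= !conjCK /d; ring.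
Qed.

(** If $l = n_0 + s$ and $l + \ell_\phi = n_0 + t$ with $s, t \leq \ell_\phi$, then $s + \ell_\phi
    \equiv t$; both sides are below $n + 1$, so they are equal and $s = 0$. *)
Lemma window_overlap phi n0 lphi l : (2 * lphi < n.+1)%N ->
  supp phi = cyclic_interval n.+1 n0%:Z lphi ->
  phi l 0 != 0 -> phi (l + residue n lphi) 0 != 0 -> l = residue n n0.
Proof.
move=> hlphi phiE l0 la0.
have inphi k : phi k 0 != 0 -> exists2 j, (j <= lphi)%N & k = residue n (n0%:Z + j%:Z).
  by move=> k0; apply/cyclic_intervalP; rewrite -phiE inE.
have [s sl lE] := inphi _ l0.
have [t tl] := inphi _ la0.
rewrite lE -residueD => /eqP; rewrite -eq_residue -addrA eqz_modDl.
rewrite -PoszD !modz_nat eqz_nat !modn_small; try lia.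
by move=> /eqP st; congr residue; lia.
Qed.

Lemma sum_shifted_productsB_le phi x y n0 lphi : (2 * lphi < n.+1)%N ->
  supp phi = cyclic_interval n.+1 n0%:Z lphi ->
  normc (periodic_ext phi n0%:Z * periodic_ext phi (n0 + lphi)%:Z) ^+ 2 *
  \sum_l normc (x (l + residue n lphi) 0 * (x l 0)^* -
                 y (l + residue n lphi) 0 * (y l 0)^*) ^+ 2 <=
  N * frobenius_norm (measurements phi x - measurements phi y) ^+ 2.
Proof.
move=> hlphi phiE; set a := residue n lphi; set r := residue n n0.
have rE : residue n (n0 + lphi)%N = r + a by rewrite PoszD residueD.
rewrite !periodic_extE rE -/r.
apply: le_trans (sum_autocorrelation_le phi x y a).
rewrite mulr_sumr (reindex_inj (addrI r)) /=.
(* Only one term of the lag-$a$ autocorrelation survives, and the shift $m$ sees the product at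
   index $r + m$; hence the reindexing by $r$ above. *)
have autocorr z m : autocorrelation (windowed phi z m) a =
    z (r + m + a) 0 * (z (r + m) 0)^* * (phi r 0 * (phi (r + a) 0)^*).
  rewrite /autocorrelation /windowed (reindex_inj (addIr (m + a))) /=.
  rewrite (bigD1 r)//= [X in _ + X]big1 ?addr0.
    rewrite addrA !addrK (addrAC _ m a) addrK rmorphM /= conjCK; ring.
  move=> l lr; have [/eqP la0|la0] := boolP (phi (l + a) 0 == 0).
    by rewrite (addrC m a) addrA addrK la0 conjC0 !mulr0 mul0r.
  have [/eqP l0|l0] := boolP (phi l 0 == 0).
    by rewrite addrA addrK addrK l0 conjC0 !mulr0 conjC0 mulr0.
  by rewrite (window_overlap hlphi phiE l0 la0) eqxx in lr.
apply: ler_sum => m _; rewrite !autocorr -mulrBl.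
by rewrite !normcM normc_conj !exprMn mulrC.
Qed.

End GaborMeasurements.

(** * Paths in the shift graph *)

Lemma path_induced_subset (T : finType) (e : rel T) (S : {set T}) (l : T)
    (p : seq T) :
  l \in S -> path (Defs.induced e S) l p -> {subset l :: p <= S}.
Proof.
move=> lS lp k; rewrite in_cons => /predU1P[->//|].
elim: p l lS lp => //= m p IHp l lS /andP[/and3P[_ mS _] mp].
by rewrite in_cons => /predU1P[->//|]; exact: IHp mp.
Qed.

Section ShiftPaths.
Variables (R : realType) (n : nat).
Local Notation G := 'I_n.+1.

(** A difference of $L - \ell_\phi$ is $-\ell_\phi$ modulo $L$, so adjacent vertices differ by
    $\pm\ell_\phi$ in the cyclic group. *)
Lemma shift_graph_residue (V : {set G}) lphi l k : (lphi <= n.+1)%N ->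
  shift_graph V lphi l k -> l = k + residue n lphi \/ k = l + residue n lphi.
Proof.
move=> lphin /and3P[_ _]; rewrite !inE.
have lkE : residue n (l%:Z - k%:Z) = l - k by rewrite residueB !residueK.
have shift d : residue n d = residue n lphi -> l%:Z - k%:Z = d ->
    l = k + residue n lphi.
  by move=> <- <-; rewrite lkE addrC subrK.
have shiftN d : residue n d = - residue n lphi -> l%:Z - k%:Z = d ->
    k = l + residue n lphi.
  by move=> dE lkd; rewrite -(opprK (residue n lphi)) -dE -lkd lkE opprB addrC subrK.
have wrap : residue n (n.+1 - lphi)%N = - residue n lphi.
  by rewrite -subzn// residueB residue_period sub0r.
have absE (d : nat) : absz (l%:Z - k%:Z) = d ->
    l%:Z - k%:Z = d%:Z \/ l%:Z - k%:Z = - d%:Z by lia.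
case/orP=> /eqP/absE[] lk.
- by left; apply: shift lk.
- by right; apply: shiftN lk; rewrite residueN.
- by right; apply: shiftN lk.
- by left; apply: shift lk; rewrite residueN wrap opprK.
Qed.

(* An edge {l, l + a} is recorded at l; on a path without repeated vertices no
   edge occurs twice, so the bounds h add up without multiplicity. *)
Lemma path_dist_le (a : G) (S : {set G}) (e : rel G) (u : G -> R[i])
    (h : G -> R) (l : G) (p : seq G) :
  (forall k m, e k m -> [/\ k \in S, m \in S & k = m + a \/ m = k + a]) ->
  (forall k, 0 <= h k) ->
  (forall k, k \in S -> k + a \in S -> normc (u (k + a) - u k) <= h k) ->
  path e l p -> uniq (l :: p) ->
  normc (u (last l p) - u l) <=
    \sum_(k | (k \in l :: p) && (k + a \in l :: p)) h k.
Proof.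
move=> eP h0 uh; elim: p l => [|m p IHp] l /=.
  by move=> _ _; rewrite subrr normc0 sumr_ge0.
move=> /andP[/eP[lS mS lm] mp] /andP[lmp /(IHp _ mp) IH].
apply: le_trans (normc_sub_triangle _ _ (u m)) _.
(* The index at which the first edge is recorded. It is absent from the sum over the tail, since $l$
   does not occur there. *)
pose d := if l == m + a then m else l.
have [dmp dl ud] : [/\ ~~ ((d \in m :: p) && (d + a \in m :: p)),
    (d \in [:: l, m & p]) && (d + a \in [:: l, m & p]) &
    normc (u m - u l) <= h d].
  rewrite /d; have [lE|lE] := eqVneq l (m + a).
    rewrite -lE (negPf lmp) andbF !in_cons !eqxx !orbT; split=> //.
    by rewrite normcB_sym lE uh// -lE.
  have mE : m = l + a by case: lm => // lma; rewrite lma eqxx in lE.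
  rewrite -mE (negPf lmp) !in_cons !eqxx !orbT; split=> //.
  by rewrite [in u m]mE uh// -mE.
rewrite (bigD1 d)//= addrC lerD//.
apply: le_trans IH _; rewrite big_mkcond [leRHS]big_mkcond /=.
apply: ler_sum => k _; case: ifPn => [kmp|_]; last by case: ifP.
have kd : k != d by apply: contraNneq dmp => <-.
move: kmp => /andP[k1 k2].
by rewrite kd (in_cons l _ k) k1 (in_cons l _ (k + a)) k2 !orbT.
Qed.

End ShiftPaths.

(** * Relative phases of $x$ and $y$, and their alignment on $S$ *)

Section PhaseAlignment.
Variable R : realType.

(** The two differences agree, up to sign, after multiplication by the unimodular number
    [csgn z' * (csgn w)^*]. This turns the change of relative phase along an edge into a difference
    of phases of products. *)
Lemma csgn_dist_conj (z z' w w' : R[i]) :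
  z != 0 -> z' != 0 -> w != 0 -> w' != 0 ->
  normc ((csgn z')^* * csgn w' - (csgn z)^* * csgn w) =
  normc (csgn (z' * z^*) - csgn (w' * w^*)).
Proof.
move=> z0 z'0 w0 w'0.
have conj1 v : v != 0 -> csgn v * (csgn v)^* = 1 :> R[i].
  by move=> v0; rewrite -normc_sqr normc_csgn// expr1n.
rewrite !csgnM !csgn_conj [LHS]normcB_sym.
have -> : csgn z' * (csgn z)^* - csgn w' * (csgn w)^* =
    csgn z' * (csgn w)^* * ((csgn z)^* * csgn w - (csgn z')^* * csgn w').
  transitivity (csgn z' * (csgn z)^* * (csgn w * (csgn w)^*) -
      csgn w' * (csgn w)^* * (csgn z' * (csgn z')^*)); last by ring.
  by rewrite !conj1// !mulr1.
by rewrite normcM normcM normc_conj !normc_csgn// !mul1r.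
Qed.

Lemma phase_alignment (n : nat) (x y : 'cV[R[i]]_n.+1) (delta : R)
    (lphi : nat) :
  (lphi <= n.+1)%N -> 0 < delta ->
  let V := large_set delta x in
  let S := V :&: supp y in
  induced_connected (shift_graph V lphi) S ->
  exists alpha, forall l, l \in S ->
    normc (csgn (x l 0) - expi alpha * csgn (y l 0)) <=
    2 / delta ^+ 2 * Num.sqrt #|S|%:R * Num.sqrt (\sum_k
      normc (x (k + residue n lphi) 0 * (x k 0)^* -
             y (k + residue n lphi) 0 * (y k 0)^*) ^+ 2).
Proof.
move=> lphin delta0 V S conn; set a := residue n lphi.
pose g k := normc (x (k + a) 0 * (x k 0)^* - y (k + a) 0 * (y k 0)^*).
rewrite -/(\sum_k g k ^+ 2).
have [S0|[r rS]] := set_0Vmem S.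
  by exists 0 => l; rewrite S0 inE.
have large l : l \in S -> delta <= normc (x l 0).
  by rewrite !inE => /andP[].
have x0 l : l \in S -> x l 0 != 0.
  by move=> /large xl; rewrite -normc_gt0 (lt_le_trans delta0).
have y0 l : l \in S -> y l 0 != 0 by rewrite !inE => /andP[].
pose u l : R[i] := (csgn (x l 0))^* * csgn (y l 0).
have nu l : l \in S -> normc (u l) = 1.
  by move=> lS; rewrite normcM normc_conj !normc_csgn ?x0 ?y0// mulr1.
(* The rotation cancels the relative phase at the root $r$; the error at $l$ is then $|u(l) -
   u(r)|$. *)
have [alpha alphaE] := @unit_circle_expi R (u r)^* (etrans (normc_conj _) (nu r rS)).
exists alpha => l lS; rewrite -alphaE.
have -> : normc (csgn (x l 0) - (u r)^* * csgn (y l 0)) = normc (u l - u r).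
  rewrite normcB_sym.
  have conj1 z : normc z = 1 -> z * z^* = 1 :> R[i].
    by move=> z1; rewrite -normc_sqr z1 expr1n.
  have -> : csgn (x l 0) - (u r)^* * csgn (y l 0) =
      csgn (x l 0) * (u r)^* * (u r - u l).
    transitivity (csgn (x l 0) * (u r * (u r)^*) - (u r)^* * csgn (y l 0) *
        (csgn (x l 0) * (csgn (x l 0))^*)); last by rewrite /u; ring.
    by rewrite !conj1 ?mulr1 ?nu ?normc_csgn ?x0.
  by rewrite normcM normcM normc_conj nu// normc_csgn ?x0// !mul1r.
(* The 2 comes from [csgn_dist_le], and $\delta^{-2}$ from $|x(k+a)\overline{x(k)}| \geq \delta^2$
   on $S$. *)
pose h k := 2 / delta ^+ 2 * g k.
have h_ge0 k : 0 <= h k.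
  by rewrite mulr_ge0 ?normc_ge0// divr_ge0// exprn_ge0// ltW.
have u_edge k : k \in S -> k + a \in S -> normc (u (k + a) - u k) <= h k.
  move=> kS kaS; rewrite csgn_dist_conj ?x0 ?y0//.
  have x0k : x (k + a) 0 * (x k 0)^* != 0 by rewrite mulf_neq0 ?conjC_eq0 ?x0.
  have y0k : y (k + a) 0 * (y k 0)^* != 0 by rewrite mulf_neq0 ?conjC_eq0 ?y0.
  apply: le_trans (csgn_dist_le x0k y0k) _.
  rewrite /h [leRHS]mulrAC ler_wpM2l ?mulr_ge0 ?normc_ge0//.
  rewrite lef_pV2 ?posrE ?exprn_gt0 ?normc_gt0// expr2 normcM normc_conj.
  by rewrite ler_pM ?large// ltW.
have eS k m : Defs.induced (shift_graph V lphi) S k m ->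
    [/\ k \in S, m \in S & k = m + a \/ m = k + a].
  by move=> /and3P[kS mS /(shift_graph_residue lphin)].
have /connectP[q] := conn r l rS lS.
case/shortenP => p rp up _ lE.
have pS := path_induced_subset rS rp.
rewrite lE; apply: le_trans (path_dist_le eS h_ge0 u_edge rp up) _.
apply: (@le_trans _ _ (\sum_(k in S) h k)).
  rewrite big_mkcond [leRHS]big_mkcond; apply: ler_sum => k _ /=.
  case: ifPn => [/andP[/pS-> _]//|_]; by case: ifP.
rewrite -mulr_sumr -[leRHS]mulrA ler_wpM2l ?divr_ge0 ?exprn_ge0 ?(ltW delta0)//.
apply: le_trans (sum_le_sqrt_card _ _) _.
rewrite ler_wpM2l ?sqrtr_ge0// ler_wsqrtr// [leLHS]big_mkcond.
by apply: ler_sum => k _; case: ifP; rewrite ?sqr_ge0.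
Qed.

(** Splits the error into a radial part, carried by the unit vector [e * csgn w], and an angular
    part of weight $|z|$. *)
Lemma normc_dist_polar (z w e : R[i]) : normc e = 1 ->
  normc (z - e * w) <=
  `|normc z - normc w| + normc z * normc (csgn z - e * csgn w).
Proof.
move=> e1; have [->|w0] := eqVneq w 0.
  rewrite mulr0 subr0 normc0 subr0 ger0_norm ?normc_ge0// lerDl.
  by rewrite mulr_ge0 ?normc_ge0.
have -> : z - e * w = (normc z - normc w)%:C * (e * csgn w) +
    (normc z)%:C * (csgn z - e * csgn w).
  rewrite -{1}(csgnK z) -{1}(csgnK w) rmorphB /=; ring.
apply: le_trans (le_normcD _ _) _.
rewrite [X in X + _]normcM [normc (e * _)]normcM [X in _ + X]normcM.
rewrite !normc_real e1 normc_csgn// !mulr1.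
by rewrite [X in _ + X * _]ger0_norm ?normc_ge0.
Qed.

(** In $|z|^2 - |w|^2 = (|z| - |w|)(|z| + |w|)$ the last factor is at least $\delta$. *)
Lemma normcB_le_sqr (z w : R[i]) (delta : R) : 0 < delta -> delta <= normc z ->
  `|normc z - normc w| <= `|normc z ^+ 2 - normc w ^+ 2| / delta.
Proof.
move=> delta0 zdelta; rewrite ler_pdivlMr// subr_sqr normrM.
rewrite ler_wpM2l// (le_trans zdelta)// (le_trans _ (ler_norm _))//.
by rewrite lerDl normc_ge0.
Qed.

End PhaseAlignment.

(** * Combination of the modulus and phase estimates on $V_\delta$ *)

Theorem theorem4p1 (R : realType) (L lphi n0 : nat) (hlphi : (2 * lphi < L)%N)
    (delta : R) (hdelta : 0 < delta)
    (B : nat) (x y : 'cV[R[i]]_L)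
    (hx : bandlimited B x) (hy : bandlimited B y)
    (phi : 'cV[R[i]]_L) (c : R) (hc : 0 < c) :
  let V := large_set delta x in
  let S := V :&: supp y in
  induced_connected (shift_graph V lphi) S ->
  supp phi = cyclic_interval L n0%:Z lphi ->
  1 / c <= min_modulus_band (dft (sqmod phi)) (2 * B) ->
  inf [set l2norm_on V (x - expi alpha *: y) | alpha in [set: R]] <=
    1 / delta *
    (c + 2 * Num.sqrt (#|S|%:R * L%:R) * l2norm_on S x /
         (delta * normc (periodic_ext phi n0%:Z * periodic_ext phi (n0 + lphi)%:Z)))
    * frobenius_norm (measurements phi x - measurements phi y).
Proof.
case: L hlphi x y hx hy phi => // n hlphi x y hx hy phi V S conn phiE cphi.
set F := frobenius_norm _; set p := normc _; set a := residue n lphi.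
have F0 : 0 <= F by exact: sqrtr_ge0.
have p0 : 0 < p.
  rewrite normc_gt0 !periodic_extE mulf_neq0//.
    have : residue n n0%:Z \in supp phi.
      by rewrite phiE; apply/cyclic_intervalP; exists 0%N; rewrite ?addr0.
    by rewrite inE.
  have : residue n (n0 + lphi)%:Z \in supp phi.
    by rewrite phiE; apply/cyclic_intervalP; exists lphi; rewrite ?PoszD.
  by rewrite inE.
pose d l := normc (x l 0) ^+ 2 - normc (y l 0) ^+ 2.
pose g l := normc (x (l + a) 0 * (x l 0)^* - y (l + a) 0 * (y l 0)^*).
have d_le : \sum_l d l ^+ 2 <= c ^+ 2 * F ^+ 2.
  by apply: (sum_sqr_modulusB_le hc hx hy); exact: cphi.
have g_le : Num.sqrt (\sum_l g l ^+ 2) <= Num.sqrt n.+1%:R * F / p.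
  have := ler_wsqrtr (sum_shifted_productsB_le x y hlphi phiE).
  rewrite [leLHS]sqrtrM ?sqr_ge0// [leRHS]sqrtrM ?ler0n// !sqrtr_sqr.
  rewrite (gtr0_norm p0) (ger0_norm F0).
  by rewrite ler_pdivlMr// mulrC.
have lphin : (lphi <= n.+1)%N by lia.
have [alpha halpha] := phase_alignment lphin hdelta conn.
(* A phase error bound uniform over $S$, from [phase_alignment] and the lag-[lphi] estimate. *)
pose D := 2 / delta ^+ 2 * Num.sqrt #|S|%:R * (Num.sqrt n.+1%:R * F / p).
have D_ge l : l \in S -> normc (csgn (x l 0) - expi alpha * csgn (y l 0)) <= D.
  move=> /halpha/le_trans; apply.
  by rewrite ler_wpM2l// mulr_ge0 ?sqrtr_ge0// divr_ge0// sqr_ge0.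
have D0 : 0 <= D.
  by rewrite !mulr_ge0 ?sqrtr_ge0 ?invr_ge0 ?sqr_ge0 ?(ltW p0).
(* On $V \setminus S$ the signal $y$ vanishes, so only the modulus error remains there. *)
pose s l := if l \in S then normc (x l 0) * D else 0.
have pointwise l : l \in V ->
    normc ((x - expi alpha *: y) l 0) <= delta^-1 * `|d l| + s l.
  move=> lV; have xl : delta <= normc (x l 0) by move: lV; rewrite inE.
  have dl : `|normc (x l 0) - normc (y l 0)| <= `|d l| / delta.
    exact: normcB_le_sqr.
  rewrite mxE [X in _ + X]mxE [X in _ - X]mxE [delta^-1 * _]mulrC /s.
  have [lS|lS] := boolP (l \in S).
    apply: le_trans (normc_dist_polar _ _ (normc_expi alpha)) _.
    by rewrite lerD// ler_wpM2l ?normc_ge0// D_ge.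
  have y0 : y l 0 = 0.
    by move: lS; rewrite finset.in_setI lV inE negbK => /eqP.
  by move: dl; rewrite y0 mulr0 normc0 !subr0 addr0 ger0_norm ?normc_ge0.
(* The infimum is at most its value at this [alpha], the set being bounded below by 0. *)
apply: (@le_trans _ _ (l2norm_on V (x - expi alpha *: y))).
  apply: ge_inf; last by exists alpha.
  by exists 0 => _ [beta _ <-]; exact: sqrtr_ge0.
apply: (@le_trans _ _ (Num.sqrt (\sum_(l in V) (delta^-1 * `|d l| + s l) ^+ 2))).
  rewrite ler_wsqrtr//; apply: ler_sum => l lV.
  rewrite ler_pXn2r ?nnegrE ?normc_ge0 ?pointwise//.
  exact: le_trans (normc_ge0 _) (pointwise _ lV).
(* Minkowski separates the modulus errors, which give $cF/\delta$, from the phase errors, which give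
   $\lVert x\rVert_{\ell^2(S)} D$. *)
apply: le_trans (sqrt_sum_sqrD_le _ _ _) _.
have dsum : Num.sqrt (\sum_(l in V) (delta^-1 * `|d l|) ^+ 2) <= delta^-1 * (c * F).
  rewrite -[leRHS]ger0_norm ?mulr_ge0 ?invr_ge0 ?(ltW hdelta) ?(ltW hc)//.
  rewrite -sqrtr_sqr ler_wsqrtr// [leRHS]exprMn [in leRHS]exprMn.
  under eq_bigr do rewrite exprMn real_normK ?num_real//.
  rewrite -mulr_sumr ler_wpM2l ?sqr_ge0// (le_trans _ d_le)// [leLHS]big_mkcond.
  by apply: ler_sum => l _; case: ifP; rewrite ?sqr_ge0.
have ssum : Num.sqrt (\sum_(l in V) s l ^+ 2) = l2norm_on S x * D.
  rewrite -(ger0_norm D0) -sqrtr_sqr -sqrtrM; last first.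
    by apply: sumr_ge0 => l _; exact: sqr_ge0.
  congr Num.sqrt; rewrite mulr_suml big_mkcond [RHS]big_mkcond /=.
  apply: eq_bigr => l _; rewrite /s /S finset.in_setI.
  by case: (l \in V) => //=; case: (l \in supp y); rewrite ?exprMn ?expr0n.
rewrite ssum; apply: le_trans (lerD dsum (lexx _)) _.
rewrite le_eqVlt; apply/orP; left; apply/eqP.
rewrite /D (sqrtrM _ (ler0n _ _)); field.
by rewrite !gt_eqF.
Qed.
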